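(* Let $X$ be a random variable taking values in $I_0=\{0,1,2,\ldots\}$ that is infinitely divisible with integer-valued components. Then $P\{X=0\}>0$.
   Context: A real random variable $X$ is infinitely divisible (ID) if for every integer $n\geq 1$ there exist independent identically distributed random variables $X_{1n},\ldots,X_{nn}$ such that $X \overset{d}{=} X_{1n}+\cdots+X_{nn}$ (equality in distribution). The variables $X_{in}$ are called the components of $X$. An ID random variable $X$ on $I_0$ is said to be ID with integer-valued components if, for every $n\geq 1$, the components $X_{1n},\ldots,X_{nn}$ take values (almost surely) in $I_0$. *)

(* Defs.v *)
From HB Require Import structures.
From mathcomp Require Import all_boot all_order all_algebra.
From mathcomp Require Import all_classical all_reals all_analysis measurable_realfun.

Set Implicit Arguments.
Unset Strict Implicit.
Unset Printing Implicit Defensive.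

Import Order.TTheory GRing.Theory Num.Theory.
Import numFieldNormedType.Exports.

Local Open Scope classical_set_scope.
Local Open Scope ring_scope.

(* The two variables may live on different probability spaces. *)
Definition eq_in_distribution (R : realType)
    (d1 : measure_display) (T1 : measurableType d1) (P1 : probability T1 R)
    (d2 : measure_display) (T2 : measurableType d2) (P2 : probability T2 R)
    (X : {RV P1 >-> R}) (Y : {RV P2 >-> R}) : Prop :=
  forall B : set R, measurable B -> distribution P1 X B = distribution P2 Y B.

Definition mutually_independent (R : realType) (d : measure_display)
    (T : measurableType d) (P : probability T R) (I : finType)
    (Y : I -> {RV P >-> R}) : Prop :=
  forall (J : {set I}) (B : I -> set R), (forall i, measurable (B i)) ->
    P (\bigcap_(i in [set` J]) (Y i @^-1` B i)) =
    (\prod_(i in J) P (Y i @^-1` B i))%E.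

Definition iid (R : realType) (d : measure_display)
    (T : measurableType d) (P : probability T R) (I : finType)
    (Y : I -> {RV P >-> R}) : Prop :=
  mutually_independent Y /\ (forall i j, eq_in_distribution (Y i) (Y j)).

Definition rv_sum (R : realType) (d : measure_display)
    (T : measurableType d) (P : probability T R) (n : nat)
    (Y : 'I_n -> {RV P >-> R}) : {RV P >-> R} :=
  \sum_(i < n) (Y i : {mfun T >-> R}).

Definition are_components (R : realType)
    (d : measure_display) (T : measurableType d) (P : probability T R)
    (X : {RV P >-> R}) (d' : measure_display) (T' : measurableType d')
    (Q : probability T' R) (n : nat) (Y : 'I_n -> {RV Q >-> R}) : Prop :=
  iid Y /\ eq_in_distribution X (rv_sum Y).

Definition infinitely_divisible (R : realType) (d : measure_display)
    (T : measurableType d) (P : probability T R) (X : {RV P >-> R}) : Prop :=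
  forall n : nat, (0 < n)%N ->
    exists (d' : measure_display) (T' : measurableType d')
      (Q : probability T' R) (Y : 'I_n -> {RV Q >-> R}),
      are_components X Y.

Definition nat_valued (R : realType) (d : measure_display)
    (T : measurableType d) (P : probability T R) (X : {RV P >-> R}) : Prop :=
  {ae P, forall w, exists k : nat, X w = k%:R}.

(* The law of the components is determined by X and n, so asking for some
   family of nat-valued components, rather than for every family of components
   to be nat-valued, gives the same notion. *)
Definition infinitely_divisible_nat_components (R : realType)
    (d : measure_display) (T : measurableType d) (P : probability T R)
    (X : {RV P >-> R}) : Prop :=
  infinitely_divisible X /\
  forall n : nat, (0 < n)%N ->
    exists (d' : measure_display) (T' : measurableType d')
      (Q : probability T' R) (Y : 'I_n -> {RV Q >-> R}),
      are_components X Y /\ forall i, nat_valued (Y i).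

(* Main.v *)
Require Import Defs.
From HB Require Import structures.
From mathcomp Require Import all_boot all_order all_algebra.
From mathcomp Require Import all_classical all_reals all_analysis measurable_realfun.

Set Implicit Arguments.
Unset Strict Implicit.
Unset Printing Implicit Defensive.

Import Order.TTheory GRing.Theory Num.Theory.
Import numFieldNormedType.Exports.

Local Open Scope classical_set_scope.
Local Open Scope ring_scope.

(** Suppose [P (X = 0) = 0] and write [X], in law, as a sum of [n] independent
    copies of a component [Y] with values in the natural numbers.  By
    independence all components vanish together with probability
    [P (Y = 0) ^ n], and then the sum vanishes as well
    ([prob_rv_sum_eq0_gt0]); hence [P (Y = 0) = 0].  A natural number other
    than [0] is at least [1], so every component is almost surely at least [1]
    and the sum is almost surely at least [n] ([prob_rv_sum_lt_eq0]).  Thus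
    [P (X < n) = 0] for every positive [n].  The events [X < n] cover the whole
    space because [X] is real-valued, and countable subadditivity contradicts
    [P setT = 1]. *)

Lemma prode_gt0 (R : realDomainType) (I : Type) (s : seq I) (p : pred I)
    (f : I -> \bar R) :
  (forall i, p i -> 0 < f i)%E -> (0 < \prod_(i <- s | p i) f i)%E.
Proof.
move=> f_gt0; elim/big_ind: _ => // x y; exact: mule_gt0.
Qed.

Lemma rv_sumE (R : realType) (d : measure_display) (T : measurableType d)
    (P : probability T R) (n : nat) (Y : 'I_n -> {RV P >-> R}) (w : T) :
  rv_sum Y w = \sum_(i < n) Y i w.
Proof. exact: mfun_sum. Qed.

(** The sum vanishes at least on the event that all the terms do, whose
    probability is a product by independence. *)
Lemma prob_rv_sum_eq0_gt0 (R : realType) (d : measure_display)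
    (T : measurableType d) (P : probability T R) (n : nat)
    (Y : 'I_n -> {RV P >-> R}) :
  mutually_independent Y ->
  (forall i, 0 < P (Y i @^-1` [set 0%R]))%E ->
  (0 < P (rv_sum Y @^-1` [set 0%R]))%E.
Proof.
move=> indepY Y0_gt0.
have m0 : measurable [set 0 : R] by exact: measurable_set1.
have := indepY [set: 'I_n]%SET (fun=> [set 0]) (fun=> m0).
set A := \bigcap_(i in _) _ => PA.
have mA : measurable A by apply: fin_bigcap_measurable.
have A_sub : A `<=` rv_sum Y @^-1` [set 0].
  move=> w Aw /=; rewrite rv_sumE big1 // => i _.
  by apply: (Aw i) => /=; rewrite inE.
have PA_gt0 : (0 < P A)%E by rewrite PA; apply: prode_gt0.
by apply: lt_le_trans PA_gt0 _; apply: le_measure; rewrite ?inE.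
Qed.

(** With identically distributed terms, either all of them or none of them
    have an atom at [0]. *)
Lemma prob_iid_eq0_eq0 (R : realType) (d : measure_display)
    (T : measurableType d) (P : probability T R) (n : nat)
    (Y : 'I_n -> {RV P >-> R}) :
  iid Y -> P (rv_sum Y @^-1` [set 0%R]) = 0%E ->
  forall i, P (Y i @^-1` [set 0%R]) = 0%E.
Proof.
move=> [indepY distY] sum0 i; apply/eqP; apply: contraT => Yi0.
have : (0 < P (rv_sum Y @^-1` [set 0%R]))%E.
  apply: prob_rv_sum_eq0_gt0 => // j.
  have -> : P (Y j @^-1` [set 0]) = P (Y i @^-1` [set 0]).
    exact: distY (measurable_set1 0).
  by rewrite lt0e Yi0 measure_ge0.
by rewrite sum0 ltxx.
Qed.

(** A natural number that is not [0] is at least [1]: outside a null set each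
    term contributes at least [1] to the sum. *)
Lemma prob_rv_sum_lt_eq0 (R : realType) (d : measure_display)
    (T : measurableType d) (P : probability T R) (n : nat)
    (Y : 'I_n -> {RV P >-> R}) :
  (forall i, nat_valued (Y i)) ->
  (forall i, P (Y i @^-1` [set 0%R]) = 0%E) ->
  P (rv_sum Y @^-1` `]-oo, n%:R[) = 0%E.
Proof.
move=> natY Y0.
have Y_ge1 : \forall w \ae P, forall i, 1 <= Y i w.
  apply: filter_forall => i.
  have Y_neq0 : \forall w \ae P, Y i w <> 0.
    exists (Y i @^-1` [set 0]); split => // w /=.
    exact: contrapT.
  apply: filterS2 (natY i) Y_neq0 => w [[|k] ->] // _.
  by rewrite ler1n.
apply: measure_negligible; first exact: measurable_funPTI.
apply: negligibleS Y_ge1 => w /=; rewrite in_itv /= => sum_lt sum_ge.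
move: sum_lt; rewrite ltNge => /negP; apply.
have -> : n%:R = \sum_(i < n) 1 :> R by rewrite sumr_const card_ord.
by rewrite rv_sumE; exact: ler_sum.
Qed.

Theorem theorem1 (R : realType) (d : measure_display) (T : measurableType d)
    (P : probability T R) (X : {RV P >-> R}) :
  nat_valued X ->
  infinitely_divisible_nat_components X ->
  (0 < P [set w | X w = 0%R])%E.
Proof.
move=> _ [_ divX]; rewrite lt0e measure_ge0 andbT; apply/eqP => X0.
have X_lt n : P (X @^-1` `]-oo, n.+1%:R[) = 0%E.
  have [d' [T' [Q [Y [[iidY XY] natY]]]]] := divX n.+1 isT.
  have -> : P (X @^-1` `]-oo, n.+1%:R[) = Q (rv_sum Y @^-1` `]-oo, n.+1%:R[).
    by apply: XY.
  apply: prob_rv_sum_lt_eq0 => //; apply: prob_iid_eq0_eq0 => //.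
  by rewrite -[LHS](XY _ (measurable_set1 0)).
have cover : \bigcup_n X @^-1` `]-oo, n.+1%:R[ = setT.
  rewrite -subTset => w _; exists (Num.Def.archi_bound `|X w|) => //=.
  rewrite in_itv /=; apply: le_lt_trans (ler_norm _) _.
  apply: lt_trans (archi_boundP (normr_ge0 _)) _.
  by rewrite ltr_nat.
have : P setT = 0%E.
  apply: measure_negligible => //; rewrite -cover.
  apply: negligible_bigcup => n.
  by apply/negligibleP; [exact: measurable_funPTI | exact: X_lt].
by rewrite probability_setT => /eqP; rewrite onee_eq0.
Qed.
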